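(* Let $n\in\mathbb{N}=\{1,2,\dots\}$ and let $A$ be an analytic function in $\mathbb{D}$ with $\|A\|_{\mathcal{L}^1}<4/n$. Then all analytic solutions $f$ in $\mathbb{D}$ of the differential equation $f''+Af=0$ satisfy $f,f^2,\dots,f^n\in\mathcal{B}$.
   Context: $\mathbb{D}=\{z\in\mathbb{C}:|z|<1\}$ is the open unit disc. For $A$ analytic in $\mathbb{D}$, $$\|A\|_{\mathcal{L}^1}=\sup_{z\in\mathbb{D}}|A(z)|(1-|z|^2)^2\log\frac{e}{1-|z|}.$$ The Bloch space $\mathcal{B}$ consists of all functions $f$ analytic in $\mathbb{D}$ with $\sup_{z\in\mathbb{D}}|f'(z)|(1-|z|^2)<\infty$. Here $f^k$ denotes the $k$-th power (product) of $f$. *)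

(* Defs.v *)
From Stdlib Require Export Reals.
From Coquelicot Require Export Coquelicot.
Open Scope R_scope.

(** Functions on the unit disc are represented by total functions [C -> C];
    only their values on the (open) disc matter below. *)
Definition disc (z : C) : Prop := Cmod z < 1.

Definition sup_disc (g : C -> R) : Rbar :=
  Lub_Rbar (fun y => exists z : C, disc z /\ y = g z).

(** Analytic means complex differentiable at every point of the disc.  Both the
    domain and the codomain carry their structure over [C_AbsRing]: the derivative
    is complex, not real. *)
Definition analytic (f : C -> C) : Prop :=
  forall z : C, disc z -> @ex_derive C_AbsRing C_NormedModule f z.

Definition L1_norm (A : C -> C) : Rbar :=
  sup_disc (fun z =>
    Cmod (A z) * (1 - Cmod z ^ 2) ^ 2 * ln (exp 1 / (1 - Cmod z))).

Definition Bloch (f : C -> C) : Prop :=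
  analytic f /\
  Rbar_lt (sup_disc (fun z => Cmod (C_derive f z) * (1 - Cmod z ^ 2))) p_infty.

(** [C_derive] is total, so [f''] is meaningful only where [f'] is differentiable.
    The clause [analytic (C_derive f)] records this; it is no restriction, since the
    derivative of an analytic function is analytic. *)
Definition analytic_solution (A f : C -> C) : Prop :=
  analytic f /\ analytic (C_derive f) /\
  forall z : C, disc z ->
    (C_derive (C_derive f) z + A z * f z = 0)%C.

(* Main.v *)
Require Import Defs.
From Stdlib Require Import Lra Lia Psatz.

(** On a radius, [f'' + A f = 0] bounds the growth of [|f|] by that of any
    positive [y] with [y'' >= |A| y] and larger initial data: as long as
    [|f| <= y] we have [|f''| <= y''], and integrating twice reproduces
    [|f'| <= y'] and [|f| <= y] ([ray_comparison]).

    Write [L(t) = 1 - ln (1 - t)], which is the logarithm in the norm of [A],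
    and [a = 1/n].  For [u = L^a],
      [u''/u = (a/L - a (1 - a)/L^2) / (1 - t)^2],
    while the hypothesis is [|A| <= c / ((1 - t^2)^2 L)] with [c < 4 a].  Since
    [(1 - t^2)^2] behaves like [4 (1 - t)^2] at the boundary, there
    [u''/u >= |A|]: this is where the constant [4/n] comes from.  Away from the
    boundary the inequality is forced by replacing [u] with
    [y = N exp (K t) L^a] for a large [K] ([majorant_supersolution]); the factor
    [N exp (K t)] is bounded, so it does not affect the order of growth.

    Hence [|f| <= y] and [|f'| <= y' = y (a / (L (1 - t)) + K)], which makes
    [|(f^k)'| (1 - |z|^2)] at most a constant times
      [y^k (a/L + K (1 - t))].
    For [k <= n] we have [y^k <= const * L^(k a) <= const * L], and
    [L (1 - t) <= 1], so this is bounded ([majorant_pow_le],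
    [logw_mult_le_1]). *)

(** * Suprema over the disc *)

Lemma sup_disc_lt (g : C -> R) (b : R) :
  Rbar_lt (sup_disc g) (Finite b) ->
  exists c, c < b /\ forall z, disc z -> g z <= c.
Proof.
  unfold sup_disc. set (E := fun y => _). intros Hlt.
  destruct (Lub_Rbar_correct E) as [Hub _].
  destruct (Lub_Rbar E) as [c | | ]; simpl in Hlt.
  - exists c. split; [exact Hlt |]. intros z Hz.
    apply (Hub (g z)). now exists z.
  - contradiction.
  - exfalso. apply (Hub (g 0)). exists 0%C. split; [| reflexivity].
    unfold disc. rewrite Cmod_0. lra.
Qed.

Lemma sup_disc_lt_p_infty (g : C -> R) (M : R) :
  (forall z, disc z -> g z <= M) -> Rbar_lt (sup_disc g) p_infty.
Proof.
  intros HM. unfold sup_disc.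
  destruct (Lub_Rbar_correct (fun y => exists z, disc z /\ y = g z)) as [_ Hleast].
  apply (Rbar_le_lt_trans _ (Finite M)); [| exact I].
  apply Hleast. intros y [z [Hz ->]]. exact (HM z Hz).
Qed.

(** * Complex derivatives *)

Lemma analytic_is_derive (f : C -> C) (z : C) :
  analytic f -> disc z -> @is_derive C_AbsRing C_NormedModule f z (C_derive f z).
Proof. intros Hf Hz. exact (C_derive_correct f z z (Hf z Hz)). Qed.

(** The little-o condition with its neighbourhood made explicit in the modulus,
    which is the metric on the domain. *)
Lemma is_derive_eps (f : C -> C) (z l : C) (eps : posreal) :
  @is_derive C_AbsRing C_NormedModule f z l ->
  exists d : posreal, forall y : C, Cmod (y - z) < d ->
    Cmod (f y - f z - (y - z) * l)%C <= eps * Cmod (y - z)%C.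
Proof.
  intros [_ Hd].
  destruct (Hd z (fun P HP => HP) eps) as [d H].
  exists d. intros y Hy. exact (H y Hy).
Qed.

(** The modulus topology and the product topology on [C] give two normed modules
    with the same norm, hence the same derivatives; the general product rule is
    stated for the former. *)
Lemma is_derive_C_AbsRing (f : C -> C) (z l : C) :
  @is_derive C_AbsRing C_NormedModule f z l <->
  @is_derive C_AbsRing (AbsRing_NormedModule C_AbsRing) f z l.
Proof.
  split; intros [[Hplus Hscal Hnorm] Hdom]; split; try exact Hdom;
    split; assumption.
Qed.

Lemma is_derive_Cpow (f : C -> C) (z l : C) (k : nat) :
  @is_derive C_AbsRing C_NormedModule f z l ->
  @is_derive C_AbsRing C_NormedModule (fun x => f x ^ S k)%C z
    (INR (S k) * f z ^ k * l)%C.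
Proof.
  intros Hf. induction k as [| k IH].
  - replace (INR 1 * f z ^ 0 * l)%C with l by (simpl; ring).
    apply (is_derive_ext (V := C_NormedModule) f); [| exact Hf].
    intros t. now rewrite Cpow_1_r.
  - pose proof (is_derive_mult (K := C_AbsRing) f (fun x => f x ^ S k)%C z _ _
                  (proj1 (is_derive_C_AbsRing _ _ _) Hf)
                  (proj1 (is_derive_C_AbsRing _ _ _) IH) Cmult_comm) as H.
    replace (INR (S (S k)) * f z ^ S k * l)%C
      with (l * f z ^ S k + f z * (INR (S k) * f z ^ k * l))%C.
    + now apply is_derive_C_AbsRing.
    + rewrite (S_INR (S k)), RtoC_plus, !Cpow_S. ring.
Qed.

(** Pairing with a fixed [w] and taking real parts gives real functions of a
    real variable, to which the real mean value theorem applies; [w = 1] and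
    [w = - Ci] recover the two coordinates. *)
Lemma is_derive_ray (f : C -> C) (u w l : C) (t : R) :
  @is_derive C_AbsRing C_NormedModule f (t * u)%C l ->
  derivable_pt_lim (fun x : R => Re (w * f (x * u))%C) t (Re (w * (u * l))%C).
Proof.
  intros Hf eps Heps.
  assert (Hw := Cmod_ge_0 w). assert (Hu := Cmod_ge_0 u).
  (* The error at [t + h] is at most [|w| |u| |h|] times the tolerance for [f];
     the [+ 1] here and in the radius below covers [w = 0] and [u = 0]. *)
  set (M := (Cmod w * Cmod u + 1)).
  assert (HM : 0 < M) by (unfold M; nra).
  assert (He : 0 < eps / M) by (apply Rdiv_lt_0_compat; lra).
  destruct (is_derive_eps f _ l (mkposreal _ He) Hf) as [d Hd]. simpl in Hd.
  assert (Hdelta : 0 < d / (Cmod u + 1))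
    by (apply Rdiv_lt_0_compat; [apply cond_pos | lra]).
  exists (mkposreal _ Hdelta). intros h Hh0 Hh. simpl in Hh.
  assert (Hah := Rabs_pos_lt h Hh0).
  assert (Hdiff : (((t + h)%R * u) - t * u = h * u)%C)
    by (rewrite RtoC_plus; ring).
  specialize (Hd ((t + h)%R * u)%C). rewrite Hdiff, Cmod_mult, Cmod_R in Hd.
  assert (Hclose : Rabs h * Cmod u < d).
  { apply (Rmult_lt_compat_r (Cmod u + 1)) in Hh; [| lra].
    unfold Rdiv in Hh. rewrite Rmult_assoc, Rinv_l, Rmult_1_r in Hh by lra. nra. }
  specialize (Hd Hclose).
  set (E := (f ((t + h)%R * u) - f (t * u) - h * u * l)%C) in Hd.
  replace ((Re (w * f ((t + h)%R * u))%C - Re (w * f (t * u))%C) / h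
           - Re (w * (u * l))%C) with (Re (w * E)%C / h).
  2:{ unfold E. destruct (f ((t + h)%R * u)%C), (f (t * u)%C), w, u, l.
      unfold Re; simpl. field. exact Hh0. }
  unfold Rdiv. rewrite Rabs_mult, Rabs_inv.
  apply (Rle_lt_trans _ (Cmod (w * E) * / Rabs h)).
  { apply Rmult_le_compat_r; [| apply re_le_Cmod].
    left. now apply Rinv_0_lt_compat. }
  rewrite Cmod_mult.
  apply (Rmult_lt_reg_r (Rabs h)); [exact Hah |].
  rewrite Rmult_assoc, Rinv_l, Rmult_1_r by lra.
  apply (Rle_lt_trans _ (Cmod w * (eps / M * (Rabs h * Cmod u)))).
  { apply Rmult_le_compat_l; assumption. }
  replace (Cmod w * (eps / M * (Rabs h * Cmod u)))
    with ((eps / M * Rabs h) * (Cmod w * Cmod u)) by ring.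
  replace (eps * Rabs h) with ((eps / M * Rabs h) * M) by (field; lra).
  apply Rmult_lt_compat_l; [nra | unfold M; lra].
Qed.

Lemma continuous_Cmod_ray (f : C -> C) (u l : C) (t : R) :
  @is_derive C_AbsRing C_NormedModule f (t * u)%C l ->
  continuity_pt (fun x : R => Cmod (f (x * u))%C) t.
Proof.
  intros Hf.
  assert (Hc : forall w, continuity_pt (fun x : R => Re (w * f (x * u))%C) t).
  { intros w. apply derivable_continuous_pt.
    exists (Re (w * (u * l))%C). now apply is_derive_ray. }
  apply (continuity_pt_ext
    (fun x : R => sqrt (Re (1 * f (x * u))%C * Re (1 * f (x * u))%C
                   + Re (- Ci * f (x * u))%C * Re (- Ci * f (x * u))%C))).
  { intros x. destruct (f (x * u)%C) as [a b].
    unfold Cmod, Re; simpl. f_equal. ring. }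
  apply (continuity_pt_comp
    (fun x : R => Re (1 * f (x * u))%C * Re (1 * f (x * u))%C
                   + Re (- Ci * f (x * u))%C * Re (- Ci * f (x * u))%C) sqrt).
  - apply continuity_pt_plus; apply continuity_pt_mult; apply Hc.
  - apply continuity_pt_sqrt. nra.
Qed.

(** * Comparison along a radius *)

Lemma disc_ray (u : C) (t : R) : Cmod u = 1 -> 0 <= t < 1 -> disc (t * u)%C.
Proof.
  intros Hu Ht. unfold disc. rewrite Cmod_mult, Cmod_R, Hu, Rabs_pos_eq; lra.
Qed.

(** The bound on the derivative is asked for only strictly inside [(0, s)], so
    that in [ray_comparison] an estimate known before [s] yields one at [s]. *)
Lemma ray_mean_value (f : C -> C) (u : C) (G G' : R -> R) (s : R) :
  analytic f -> Cmod u = 1 -> 0 <= s < 1 ->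
  (forall t, 0 <= t < 1 -> derivable_pt_lim G t (G' t)) ->
  (forall t, 0 < t < s -> Cmod (C_derive f (t * u)%C) <= G' t) ->
  Cmod (f (s * u)%C) - Cmod (f 0) <= G s - G 0.
Proof.
  intros Hf Hu Hs HG Hle.
  destruct (Req_dec s 0) as [-> | Hs0].
  { rewrite Cmult_0_l. lra. }
  set (D := (f (s * u) - f 0)%C).
  assert (HD : Cmod (f (s * u)%C) - Cmod (f 0) <= Cmod D).
  { assert (H := Cmod_triangle D (f 0)).
    replace (D + f 0)%C with (f (s * u)%C) in H by (unfold D; ring). lra. }
  (* A unimodular [w] rotating the increment onto the positive real axis
     reduces the claim to the real mean value theorem. *)
  assert (Hw : exists w, Cmod w = 1 /\ Re (w * D)%C = Cmod D).
  { destruct (Ceq_dec D 0) as [H0 | H0].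
    - exists 1%C. rewrite H0, Cmod_1, Cmod_0. split; [reflexivity |].
      unfold Re; simpl; ring.
    - assert (HDp := proj1 (Cmod_gt_0 D) H0).
      assert (HDc : RtoC (Cmod D) <> 0) by (intros H; apply RtoC_inj in H; lra).
      exists (Cconj D / Cmod D)%C. split.
      + rewrite Cmod_div, Cmod_conj, Cmod_R, Rabs_pos_eq by (assumption || lra).
        field. lra.
      + replace (Cconj D / Cmod D * D)%C with (RtoC (Cmod D)); [reflexivity |].
        replace (Cconj D / Cmod D * D)%C with (D * Cconj D / Cmod D)%C
          by (field; exact HDc).
        rewrite <- Cmod2_conj, RtoC_pow. field. exact HDc. }
  destruct Hw as [w [Hw1 HwD]].
  destruct (MVT_cor2 (fun t : R => Re (w * f (t * u))%C - G t)
    (fun t : R => Re (w * (u * C_derive f (t * u)))%C - G' t) 0 s)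
    as [c [Hc1 Hc2]]; [lra | |].
  { intros t Ht. apply derivable_pt_lim_minus.
    - apply is_derive_ray, analytic_is_derive; [exact Hf |].
      apply disc_ray; [exact Hu | lra].
    - apply HG. lra. }
  assert (Hre : Re (w * (u * C_derive f (c * u)))%C <= G' c).
  { apply (Rle_trans _ (Cmod (w * (u * C_derive f (c * u))))%C).
    - eapply Rle_trans; [apply Rle_abs | apply re_le_Cmod].
    - rewrite !Cmod_mult, Hw1, Hu, !Rmult_1_l. now apply Hle. }
  assert (Hexp : Re (w * D)%C = Re (w * f (s * u))%C - Re (w * f (0 * u))%C).
  { unfold D. rewrite Cmult_0_l.
    destruct w, (f (s * u)%C), (f 0). unfold Re; simpl; ring. }
  rewrite HwD in Hexp. nra.
Qed.

(** Let [s] be the supremum of the parameters up to which [|f| <= y].  Two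
    applications of the mean value inequality, to [f'] against [y'] and then to
    [f] against [y], preserve the initial gap [y 0 - |f 0| > 0] at [s]; so the
    inequality at [s] is strict and, by continuity, persists a little beyond.
    The argument is run below a fixed [T < 1] to keep [s] inside the disc. *)
Lemma ray_comparison (A f : C -> C) (u : C) (y y' y'' : R -> R) :
  analytic_solution A f -> Cmod u = 1 ->
  (forall t, 0 <= t < 1 -> derivable_pt_lim y t (y' t)) ->
  (forall t, 0 <= t < 1 -> derivable_pt_lim y' t (y'' t)) ->
  (forall t, 0 <= t < 1 -> Cmod (A (t * u)%C) * y t <= y'' t) ->
  Cmod (f 0) < y 0 -> Cmod (C_derive f 0) <= y' 0 ->
  forall t, 0 <= t < 1 ->
    Cmod (f (t * u)%C) <= y t /\ Cmod (C_derive f (t * u)%C) <= y' t.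
Proof.
  intros [Hf [Hf' Heq]] Hu Hy Hy' HA H0 H0'.
  assert (Hder : forall s, 0 <= s < 1 ->
    (forall t, 0 < t < s -> Cmod (f (t * u)%C) <= y t) ->
    Cmod (C_derive f (s * u)%C) <= y' s).
  { intros s Hs Hlt.
    enough (Cmod (C_derive f (s * u)%C) - Cmod (C_derive f 0) <= y' s - y' 0)
      by lra.
    apply (ray_mean_value _ _ y' y''); try assumption.
    intros t Ht.
    assert (Hz : disc (t * u)%C) by (apply disc_ray; [exact Hu | lra]).
    replace (C_derive (C_derive f) (t * u)%C)
      with (- (A (t * u) * f (t * u)))%C.
    2:{ specialize (Heq _ Hz).
        replace (C_derive (C_derive f) (t * u)%C)
          with (C_derive (C_derive f) (t * u) + A (t * u) * f (t * u)
                - A (t * u) * f (t * u))%C by ring.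
        rewrite Heq. ring. }
    rewrite Cmod_opp, Cmod_mult.
    apply (Rle_trans _ (Cmod (A (t * u)%C) * y t)).
    - apply Rmult_le_compat_l; [apply Cmod_ge_0 | now apply Hlt].
    - apply HA. lra. }
  assert (Hstrict : forall s, 0 <= s < 1 ->
    (forall t, 0 <= t < s -> Cmod (f (t * u)%C) <= y t) ->
    Cmod (f (s * u)%C) < y s).
  { intros s Hs Hlt.
    enough (Cmod (f (s * u)%C) - Cmod (f 0) <= y s - y 0) by lra.
    apply (ray_mean_value _ _ y y'); try assumption.
    intros t Ht. apply Hder; [lra |]. intros r Hr. apply Hlt. lra. }
  assert (Hall : forall T, 0 <= T < 1 ->
    forall t, 0 <= t < T -> Cmod (f (t * u)%C) <= y t).
  { intros T HT.
    set (S := fun s => 0 <= s <= T /\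
                forall t, 0 <= t < s -> Cmod (f (t * u)%C) <= y t).
    assert (HS0 : S 0) by (split; [lra | intros; lra]).
    destruct (completeness S) as [s [Hub Hleast]].
    { exists T. intros x [Hx _]. lra. }
    { now exists 0. }
    assert (Hs : 0 <= s <= T).
    { split; [now apply Hub |]. apply Hleast. intros x [Hx _]. lra. }
    assert (Hbelow : forall t, 0 <= t < s -> Cmod (f (t * u)%C) <= y t).
    { intros t Ht.
      apply Rnot_lt_le. intros Hbad.
      apply (Rlt_not_le s t); [lra |]. apply Hleast. intros x [_ Hx].
      apply Rnot_lt_le. intros Hxt. specialize (Hx t (conj (proj1 Ht) Hxt)). lra. }
    destruct (Req_dec s T) as [-> | HsT]; [exact Hbelow |].
    exfalso.
    assert (Hs1 : 0 <= s < 1) by lra.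
    assert (Hgap := Hstrict s Hs1 Hbelow).
    assert (Hcont : continuity_pt (fun x : R => y x - Cmod (f (x * u)%C)) s).
    { apply continuity_pt_minus.
      - apply derivable_continuous_pt. exists (y' s). now apply Hy.
      - apply (continuous_Cmod_ray f u (C_derive f (s * u)%C)).
        apply analytic_is_derive; [exact Hf | now apply disc_ray]. }
    destruct (Hcont (y s - Cmod (f (s * u)%C))) as [d [Hd Hnear]]; [lra |].
    simpl in Hnear. unfold R_dist in Hnear.
    set (s' := Rmin (s + d / 2) T).
    assert (Hs' : s < s' <= T /\ s' <= s + d / 2).
    { unfold s'. repeat split; [apply Rmin_glb_lt; lra | apply Rmin_r | apply Rmin_l]. }
    apply (Rlt_not_le s' s); [lra |]. apply Hub. split; [lra |].
    intros t Ht. destruct (Rlt_le_dec t s) as [Hts | Hts]; [apply Hbelow; lra |].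
    destruct (Req_dec t s) as [-> | Hne]; [lra |].
    assert (Hclose : Rabs (t - s) < d) by (rewrite Rabs_pos_eq; lra).
    assert (H := Hnear t). 
    specialize (H (conj (conj I (not_eq_sym Hne)) Hclose)).
    apply Rabs_def2 in H. lra. }
  intros t Ht.
  assert (Hbelow : forall r, 0 <= r < t -> Cmod (f (r * u)%C) <= y r).
  { exact (Hall t Ht). }
  split.
  - left. now apply Hstrict.
  - apply Hder; [exact Ht |]. intros r Hr. apply Hbelow. lra.
Qed.

(** * The logarithmic supersolution *)

Definition logw (t : R) : R := 1 - ln (1 - t).

Definition majorant (N a K t : R) : R := N * exp (a * ln (logw t) + K * t).

(** The logarithmic derivative of [majorant N a K]. *)
Definition majorant_slope (a K t : R) : R := a / (logw t * (1 - t)) + K.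

(** The derivative of [majorant_slope a K]; with [y] the majorant and [p] its
    slope, [y'' = y (p^2 + p')]. *)
Definition majorant_slope' (a t : R) : R :=
  a * (logw t - 1) / (logw t * (1 - t)) ^ 2.

Lemma exp_monotone (x y : R) : x <= y -> exp x <= exp y.
Proof. intros [H | ->]; [left; now apply exp_increasing | apply Rle_refl]. Qed.

Lemma ln_e_div (s : R) : 0 < s -> ln (exp 1 / s) = 1 - ln s.
Proof.
  intros Hs. unfold Rdiv.
  rewrite ln_mult, ln_exp, ln_Rinv; [ring | assumption | apply exp_pos |].
  now apply Rinv_0_lt_compat.
Qed.

Lemma logw_ge_1 (t : R) : 0 <= t < 1 -> 1 <= logw t.
Proof.
  intros Ht. unfold logw. enough (ln (1 - t) <= ln 1) by (rewrite ln_1 in *; lra).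
  apply ln_le; lra.
Qed.

(** With [x = - ln (1 - t)] this is [1 + x <= exp x]. *)
Lemma logw_mult_le_1 (t : R) : 0 <= t < 1 -> logw t * (1 - t) <= 1.
Proof.
  intros Ht. unfold logw.
  assert (H := exp_ineq1_le (- ln (1 - t))).
  rewrite exp_Ropp, exp_ln in H by lra.
  apply (Rmult_le_compat_r (1 - t)) in H; [| lra].
  rewrite Rinv_l in H by lra. lra.
Qed.

Lemma derivable_logw (t : R) :
  0 <= t < 1 -> derivable_pt_lim logw t (/ (1 - t)).
Proof.
  intros Ht. apply is_derive_Reals. unfold logw.
  auto_derive; [lra | field; lra].
Qed.

Lemma derivable_majorant (N a K t : R) :
  0 <= t < 1 ->
  derivable_pt_lim (majorant N a K) t (majorant N a K t * majorant_slope a K t).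
Proof.
  intros Ht. assert (HL := logw_ge_1 t Ht).
  assert (Hd := derivable_logw t Ht).
  apply is_derive_Reals. apply is_derive_Reals in Hd.
  assert (HD : Derive (fun x : R => logw x) t = / (1 - t))
    by now apply is_derive_unique.
  unfold majorant, majorant_slope.
  auto_derive.
  - repeat split; [now exists (/ (1 - t)) | lra].
  - rewrite HD. field. lra.
Qed.

Lemma derivable_majorant_slope (a K t : R) :
  0 <= t < 1 ->
  derivable_pt_lim (majorant_slope a K) t (majorant_slope' a t).
Proof.
  intros Ht. assert (HL := logw_ge_1 t Ht).
  assert (Hd := derivable_logw t Ht).
  apply is_derive_Reals. apply is_derive_Reals in Hd.
  assert (HD : Derive (fun x : R => logw x) t = / (1 - t))
    by now apply is_derive_unique.
  unfold majorant_slope, majorant_slope'.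
  auto_derive.
  - repeat split; [now exists (/ (1 - t)) |]. nra.
  - rewrite HD. field. lra.
Qed.

(** Raising to the power [k] turns [L^a] into [L^(k a)], and [L >= 1]. *)
Lemma majorant_pow_le (N a K t : R) (k : nat) :
  0 <= N -> 0 <= K -> INR k * a <= 1 -> 0 <= t < 1 ->
  majorant N a K t ^ k <= (N * exp K) ^ k * logw t.
Proof.
  intros HN HK Hk Ht. assert (HL := logw_ge_1 t Ht).
  unfold majorant. rewrite exp_plus, !Rpow_mult_distr.
  assert (Hlog : exp (a * ln (logw t)) ^ k <= logw t).
  { rewrite <- Rpower_pow by apply exp_pos. unfold Rpower.
    rewrite ln_exp. rewrite <- (exp_ln (logw t)) at 2 by lra.
    apply exp_monotone. rewrite <- Rmult_assoc. rewrite <- (Rmult_1_l (ln (logw t))) at 2.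
    apply Rmult_le_compat_r; [| exact Hk].
    rewrite <- ln_1. apply ln_le; lra. }
  assert (Hexp : exp (K * t) ^ k <= exp K ^ k).
  { apply pow_incr. split; [left; apply exp_pos | apply exp_monotone; nra]. }
  rewrite Rmult_assoc. apply Rmult_le_compat_l; [now apply pow_le |].
  rewrite Rmult_comm. apply Rmult_le_compat; try assumption;
    apply pow_le; left; apply exp_pos.
Qed.

(** After multiplication by [(L (1 - t))^2] the claim reads
      [c L / (1 + t)^2 <= (a + K (1 - t) L)^2 + a (L - 1)].
    Replacing [1 / (1 + t)^2] by its boundary value [1/4] costs at most
    [c (1 - t) L], absorbed by the cross term of the square once [2 K a >= c].
    What remains follows from [a <= (a - c/4) L + (K (1 - t) L)^2]: close to the
    boundary [L] is large, and elsewhere [1 - t] is bounded below, by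
    [exp (1 - a/d)] with [d = a - c/4], so that [K >= exp (a/d)] suffices. *)
Lemma majorant_supersolution (a c : R) :
  0 < a <= 1 -> 0 <= c < 4 * a ->
  exists K, 1 <= K /\ forall t, 0 <= t < 1 ->
    c / ((1 - t ^ 2) ^ 2 * logw t)
      <= majorant_slope a K t ^ 2 + majorant_slope' a t.
Proof.
  intros Ha Hc. set (d := a - c / 4). assert (Hd : 0 < d) by (unfold d; lra).
  assert (Had : 0 < a / d) by (apply Rdiv_lt_0_compat; lra).
  assert (Hca : 0 <= c / (2 * a)) by (apply Rdiv_le_0_compat; lra).
  assert (Hexp := exp_ineq1_le (a / d)).
  exists (c / (2 * a) + exp (a / d)). set (K := c / (2 * a) + exp (a / d)).
  assert (HK : 1 <= K) by (unfold K; lra).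
  split; [exact HK |]. intros t Ht.
  assert (HL := logw_ge_1 t Ht). set (L := logw t) in *.
  assert (HKc : c <= 2 * K * a).
  { replace c with (c / (2 * a) * (2 * a)) by (field; lra).
    unfold K. nra. }
  assert (Hcore : a <= d * L + (K * (1 - t) * L) ^ 2).
  { assert (Hsq := pow2_ge_0 (K * (1 - t) * L)).
    destruct (Rle_lt_dec a (d * L)) as [H | H]; [lra |].
    assert (HLd : L < a / d).
    { apply (Rmult_lt_reg_r d); [exact Hd |].
      unfold Rdiv. rewrite Rmult_assoc, Rinv_l; lra. }
    assert (Hs : exp (1 - a / d) < 1 - t).
    { rewrite <- (exp_ln (1 - t)) by lra. apply exp_increasing.
      unfold L, logw in HLd. lra. }
    assert (H1 : exp (a / d) * exp (1 - a / d) = exp 1)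
      by (rewrite <- exp_plus; f_equal; ring).
    assert (He := exp_ineq1_le 1). assert (Hp := exp_pos (1 - a / d)).
    assert (HKs : 1 <= K * (1 - t)).
    { apply (Rle_trans _ (exp (a / d) * exp (1 - a / d))); [lra |].
      apply Rmult_le_compat; unfold K; lra. }
    assert (1 <= K * (1 - t) * L) by nra. nra. }
  assert (Hc2 : c / (1 + t) ^ 2 <= c / 4 + c * (1 - t)).
  { apply (Rmult_le_reg_r ((1 + t) ^ 2)); [nra |].
    unfold Rdiv. rewrite Rmult_assoc, Rinv_l, Rmult_1_r by nra.
    enough (0 <= c * ((/ 4 + (1 - t)) * (1 + t) ^ 2 - 1)) by nra.
    apply Rmult_le_pos; [lra |]. nra. }
  unfold majorant_slope, majorant_slope'. fold L.
  apply (Rmult_le_reg_r ((L * (1 - t)) ^ 2)); [apply pow_lt; nra |].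
  replace (c / ((1 - t ^ 2) ^ 2 * L) * (L * (1 - t)) ^ 2)
    with (c / (1 + t) ^ 2 * L)
    by (field; repeat split; try nra; lra).
  replace (((a / (L * (1 - t)) + K) ^ 2 + a * (L - 1) / (L * (1 - t)) ^ 2) *
            (L * (1 - t)) ^ 2)
    with ((a + K * (1 - t) * L) ^ 2 + a * (L - 1)) by (field; lra).
  apply (Rle_trans _ ((c / 4 + c * (1 - t)) * L)).
  { apply Rmult_le_compat_r; lra. }
  assert (0 <= (2 * K * a - c) * ((1 - t) * L)).
  { apply Rmult_le_pos; [lra |]. apply Rmult_le_pos; lra. }
  unfold d in Hcore. nra.
Qed.

(** * Bloch powers *)

Lemma polar_form (z : C) : exists u, Cmod u = 1 /\ z = (Cmod z * u)%C.
Proof.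
  destruct (Ceq_dec z 0) as [-> | Hz].
  - exists 1%C. rewrite Cmod_1, Cmod_0. split; [reflexivity | ring].
  - assert (Hp := proj1 (Cmod_gt_0 z) Hz).
    assert (Hc : RtoC (Cmod z) <> 0) by (intros H; apply RtoC_inj in H; lra).
    exists (z / Cmod z)%C. split; [| field; exact Hc].
    rewrite Cmod_div, Cmod_R, Rabs_pos_eq by (assumption || lra). field. lra.
Qed.

Lemma solution_growth (A f : C -> C) (a c : R) :
  0 < a <= 1 -> 0 <= c < 4 * a ->
  (forall z, disc z ->
     Cmod (A z) * (1 - Cmod z ^ 2) ^ 2 * ln (exp 1 / (1 - Cmod z)) <= c) ->
  analytic_solution A f ->
  exists N K, 0 <= N /\ 0 <= K /\ forall z, disc z ->
    Cmod (f z) <= majorant N a K (Cmod z) /\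
    Cmod (C_derive f z)
      <= majorant N a K (Cmod z) * majorant_slope a K (Cmod z).
Proof.
  intros Ha Hc HA Hf.
  destruct (majorant_supersolution a c Ha Hc) as [K [HK Hsup]].
  assert (H0 := Cmod_ge_0 (f 0)). assert (H0' := Cmod_ge_0 (C_derive f 0)).
  (* The majorant starts at [N] with slope [N (a + K) >= N], so this [N]
     dominates both initial values, the first one strictly. *)
  set (N := 1 + Cmod (f 0) + Cmod (C_derive f 0)).
  exists N, K. assert (HN : 1 <= N) by (unfold N; lra).
  split; [lra |]. split; [lra |]. intros z Hz.
  destruct (polar_form z) as [u [Hu Hzu]].
  assert (Hr : 0 <= Cmod z < 1) by (split; [apply Cmod_ge_0 | exact Hz]).
  rewrite Hzu at 1 3.
  assert (Hm0 : majorant N a K 0 = N).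
  { unfold majorant, logw. rewrite Rminus_0_r, ln_1, Rminus_0_r, ln_1, !Rmult_0_r,
      Rplus_0_r, exp_0. ring. }
  apply (ray_comparison A f u (majorant N a K)
    (fun t => majorant N a K t * majorant_slope a K t)
    (fun t => majorant N a K t
                * (majorant_slope a K t ^ 2 + majorant_slope' a t)));
    try assumption.
  - intros t Ht. now apply derivable_majorant.
  - intros t Ht.
    replace (majorant N a K t * (majorant_slope a K t ^ 2 + majorant_slope' a t))
      with (majorant N a K t * majorant_slope a K t * majorant_slope a K t
            + majorant N a K t * majorant_slope' a t) by ring.
    apply (derivable_pt_lim_mult (majorant N a K) (majorant_slope a K)).
    + now apply derivable_majorant.
    + now apply derivable_majorant_slope.
  - intros t Ht. rewrite Rmult_comm. apply Rmult_le_compat_l.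
    { unfold majorant. apply Rmult_le_pos; [lra | left; apply exp_pos]. }
    eapply Rle_trans; [| now apply Hsup].
    assert (HL := logw_ge_1 t Ht).
    assert (HAt := HA _ (disc_ray u t Hu Ht)).
    rewrite Cmod_mult, Cmod_R, Hu, Rmult_1_r, Rabs_pos_eq, ln_e_div in HAt by lra.
    fold (logw t) in HAt.
    assert (0 < (1 - t ^ 2) ^ 2) by (apply pow_lt; nra).
    apply (Rmult_le_reg_r ((1 - t ^ 2) ^ 2 * logw t)); [nra |].
    unfold Rdiv. rewrite (Rmult_assoc c), Rinv_l by nra. lra.
  - rewrite Hm0. unfold N. lra.
  - rewrite Hm0. unfold majorant_slope.
    assert (Hl0 : logw 0 = 1) by (unfold logw; rewrite Rminus_0_r, ln_1; ring).
    rewrite Hl0. replace (a / (1 * (1 - 0)) + K) with (a + K) by field.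
    unfold N in *. nra.
Qed.

Theorem theorem2 (n : nat) (hn : (1 <= n)%nat) (A : C -> C)
  (hA : analytic A) (hnorm : Rbar_lt (L1_norm A) (Finite (4 / INR n)))
  (f : C -> C) (hf : analytic_solution A f)
  (k : nat) (hk1 : (1 <= k)%nat) (hkn : (k <= n)%nat) :
  Bloch (fun z : C => (f z ^ k)%C).
Proof.
  destruct k as [| k]; [lia |].
  assert (Hn : 1 <= INR n) by (apply (le_INR 1); exact hn).
  assert (Hkn : INR (S k) <= INR n) by (apply le_INR; exact hkn).
  assert (Hpow : forall z, disc z ->
    @is_derive C_AbsRing C_NormedModule (fun z => f z ^ S k)%C z
      (INR (S k) * f z ^ k * C_derive f z)%C).
  { intros z Hz. apply is_derive_Cpow, analytic_is_derive; [apply hf | exact Hz]. }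
  split.
  { intros z Hz. eexists. exact (Hpow z Hz). }
  destruct (sup_disc_lt _ _ hnorm) as [c [Hc HA]].
  set (a := / INR n).
  assert (Ha : 0 < a <= 1).
  { split; [apply Rinv_0_lt_compat; lra |].
    unfold a. rewrite <- Rinv_1. apply Rinv_le_contravar; lra. }
  assert (Hka : INR (S k) * a <= 1).
  { apply (Rmult_le_reg_r (INR n)); [lra |].
    unfold a. rewrite Rmult_assoc, Rinv_l; lra. }
  assert (Hc0 : 0 <= c).
  { eapply Rle_trans; [| apply (HA 0)].
    - rewrite Cmod_0, Rminus_0_r, ln_e_div, ln_1 by lra.
      assert (H := Cmod_ge_0 (A 0)). simpl. lra.
    - unfold disc. rewrite Cmod_0. lra. }
  destruct (solution_growth A f a c) as [N [K [HN [HK Hgrow]]]]; try assumption.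
  { split; [exact Hc0 |]. exact Hc. }
  set (B := (N * exp K) ^ S k).
  assert (HB : 0 <= B).
  { apply pow_le, Rmult_le_pos; [exact HN | left; apply exp_pos]. }
  apply (sup_disc_lt_p_infty _ (INR (S k) * B * (a + K) * 2)).
  intros z Hz.
  replace (C_derive (fun x : C => (f x ^ S k)%C) z)
    with (INR (S k) * f z ^ k * C_derive f z)%C
    by (symmetry; exact (is_C_derive_unique _ _ _ (Hpow z Hz))).
  destruct (Hgrow z Hz) as [H0 H1]. clear Hgrow.
  rewrite !Cmod_mult, Cmod_R, Cmod_pow, (Rabs_pos_eq (INR (S k))) by apply pos_INR.
  assert (Ht : 0 <= Cmod z < 1) by (split; [apply Cmod_ge_0 | exact Hz]).
  set (t := Cmod z) in *.
  assert (HM := majorant_pow_le N a K t (S k) HN HK Hka Ht). fold B in HM.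
  assert (HL := logw_ge_1 t Ht). assert (HL1 := logw_mult_le_1 t Ht).
  set (m := majorant N a K t) in *.
  assert (Hslope : 0 <= majorant_slope a K t).
  { unfold majorant_slope. apply Rplus_le_le_0_compat; [| exact HK].
    apply Rdiv_le_0_compat; nra. }
  assert (Hfk := pow_incr _ _ k (conj (Cmod_ge_0 (f z)) H0)).
  assert (Hprod : Cmod (f z) ^ k * Cmod (C_derive f z)
                    <= B * logw t * majorant_slope a K t).
  { apply (Rle_trans _ (m ^ k * (m * majorant_slope a K t))).
    - apply Rmult_le_compat; try assumption; [apply pow_le |]; apply Cmod_ge_0.
    - rewrite <- Rmult_assoc, (Rmult_comm (m ^ k)).
      apply Rmult_le_compat_r; assumption. }
  assert (Hlast : logw t * majorant_slope a K t * (1 - t) <= a + K).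
  { unfold majorant_slope.
    replace (logw t * (a / (logw t * (1 - t)) + K) * (1 - t))
      with (a + K * (logw t * (1 - t))) by (field; lra).
    nra. }
  rewrite !(Rmult_assoc (INR (S k))).
  apply Rmult_le_compat_l; [apply pos_INR |].
  replace (1 - t ^ 2) with ((1 - t) * (1 + t)) by ring.
  apply (Rle_trans _ (B * logw t * majorant_slope a K t * ((1 - t) * (1 + t)))).
  { apply Rmult_le_compat_r; [nra | exact Hprod]. }
  replace (B * logw t * majorant_slope a K t * ((1 - t) * (1 + t)))
    with (B * (logw t * majorant_slope a K t * (1 - t)) * (1 + t)) by ring.
  apply Rmult_le_compat; [| lra | now apply Rmult_le_compat_l | lra].
  apply Rmult_le_pos; [exact HB |].
  apply Rmult_le_pos; [apply Rmult_le_pos |]; lra.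
Qed.
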